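(* Let $(R_1,P_{R_1})\stackrel{f_1}{\longleftarrow}(R_0,P_{R_0})\stackrel{f_2}{\longrightarrow}(R_2,P_{R_2})$ be a diagram of morphisms of commutative Rota-Baxter $\mathbf{k}$-algebras of weight $\lambda$. Let $R_1\otimes_{R_0}R_2$ be the tensor product of $R_1$ and $R_2$ as $R_0$-algebras, with pure tensors written $r_1\Box r_2$, and let $\mathrm{Sha}(R_1\otimes_{R_0}R_2)$ be the free commutative Rota-Baxter algebra on it, with pure tensors written using $\otimes$. Let $\mathcal{I}$ be the Rota-Baxter ideal of $\mathrm{Sha}(R_1\otimes_{R_0}R_2)$ generated by the set $$\big\{P_{R_1}(r_1)\Box 1-(1\Box 1)\otimes(r_1\Box 1)\ \big|\ r_1\in R_1\big\}\cup\big\{1\Box P_{R_2}(r_2)-(1\Box 1)\otimes(1\Box r_2)\ \big|\ r_2\in R_2\big\}.$$ Then the quotient Rota-Baxter algebra $\mathrm{Sha}(R_1\otimes_{R_0}R_2)/\mathcal{I}$, with the operator induced from that of $\mathrm{Sha}(R_1\otimes_{R_0}R_2)$ and with the canonical maps $k_1:R_1\to\mathrm{Sha}(R_1\otimes_{R_0}R_2)/\mathcal{I}$, $r_1\mapsto\overline{r_1\Box 1}$, and $k_2:R_2\to\mathrm{Sha}(R_1\otimes_{R_0}R_2)/\mathcal{I}$, $r_2\mapsto\overline{1\Box r_2}$, is the Rota-Baxter tensor product of $(R_1,P_{R_1})$ and $(R_2,P_{R_2})$ over $(R_0,P_{R_0})$.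
   Context: $\mathbf{k}$ is a commutative unitary ring, $\lambda\in\mathbf{k}$ is fixed, and all algebras are commutative unital $\mathbf{k}$-algebras. A Rota-Baxter algebra of weight $\lambda$ is a pair $(R,P)$ with $R$ an algebra and $P:R\to R$ a $\mathbf{k}$-linear map satisfying $P(x)P(y)=P(xP(y)+P(x)y+\lambda xy)$ for all $x,y\in R$. A morphism $f:(R,P)\to(R',P')$ is an algebra homomorphism with $f\circ P=P'\circ f$. A Rota-Baxter ideal is an ideal closed under $P$; the quotient by a Rota-Baxter ideal carries the operator $\overline{P}(\overline{a})=\overline{P(a)}$. The Rota-Baxter tensor product of $(R_1,P_{R_1})$ and $(R_2,P_{R_2})$ over $(R_0,P_{R_0})$ is the colimit (pushout) of the diagram $(R_1,P_{R_1})\leftarrow(R_0,P_{R_0})\to(R_2,P_{R_2})$ in the category of commutative Rota-Baxter $\mathbf{k}$-algebras of weight $\lambda$. Free commutative Rota-Baxter algebra on a commutative algebra $A$: $\mathrm{Sha}(A)=\bigoplus_{k\ge 1}A^{\otimes k}$ (tensor over $\mathbf{k}$), with product $\diamond$ defined on $\mathfrak a=a_0\otimes\cdots\otimes a_m$, $\mathfrak b=b_0\otimes\cdots\otimes b_n$ by: $\mathfrak a\diamond\mathfrak b=(a_0b_0)\otimes b_1\otimes\cdots\otimes b_n$ if $m=0$; $\mathfrak a\diamond\mathfrak b=(a_0b_0)\otimes a_1\otimes\cdots\otimes a_m$ if $n=0$; and for $m,n>0$, inductively, $$\mathfrak a\diamond\mathfrak b=(a_0b_0)\otimes\big((a_1\otimes\cdots\otimes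 a_m)\diamond(1\otimes b_1\otimes\cdots\otimes b_n)+(1\otimes a_1\otimes\cdots\otimes a_m)\diamond(b_1\otimes\cdots\otimes b_n)+\lambda(a_1\otimes\cdots\otimes a_m)\diamond(b_1\otimes\cdots\otimes b_n)\big).$$ Its Rota-Baxter operator is $x_0\otimes\cdots\otimes x_n\mapsto 1\otimes x_0\otimes\cdots\otimes x_n$. *)

(* Defs.v *)
(* The classical axioms of boolp serve to take quotients by submodules and    *)
(* ideals that need not be decidable, and to make direct sums choiceTypes.    *)
From HB Require Import structures.
From mathcomp Require Import all_boot all_algebra.
From mathcomp Require Import generic_quotient ring_quotient.
From mathcomp Require Import finmap monalg boolp.

Set Implicit Arguments.
Unset Strict Implicit.
Unset Printing Implicit Defensive.

Import GRing.Theory.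

Local Open Scope ring_scope.
Local Open Scope quotient_scope.

(* MathComp's [comAlgType k] excludes the zero algebra, which is a legitimate  *)
(* commutative unital algebra and may arise here as a tensor product or as a   *)
(* quotient. So a commutative unital k-algebra is a [comPzRingType] with a     *)
(* unital ring morphism from k, the scaling being c *: x = algmap c * x.       *)
HB.mixin Record ComPzRing_isAlg (k : comPzRingType) A of GRing.ComPzRing A := {
  algmap : k -> A;
  algmap_zmod : zmod_morphism algmap;
  algmap_monoid : monoid_morphism algmap
}.

#[short(type="comPzAlgType")]
HB.structure Definition ComPzAlg (k : comPzRingType) :=
  {A of GRing.ComPzRing A & ComPzRing_isAlg k A}.

Arguments algmap {k s} : rename.

Section ComPzAlgTheory.
Variables (k : comPzRingType) (A : comPzAlgType k).
Implicit Types (a b c : k) (x y : A).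

HB.instance Definition _ :=
  GRing.isZmodMorphism.Build k A (@algmap k A) algmap_zmod.
HB.instance Definition _ :=
  GRing.isMonoidMorphism.Build k A (@algmap k A) algmap_monoid.

Definition alg_scale c x := algmap c * x.

Lemma alg_scalerA a b x : alg_scale a (alg_scale b x) = alg_scale (a * b) x.
Proof. by rewrite /alg_scale mulrA rmorphM. Qed.
Lemma alg_scale1r : left_id 1 alg_scale.
Proof. by move=> x; rewrite /alg_scale rmorph1 mul1r. Qed.
Lemma alg_scalerDr : right_distributive alg_scale +%R.
Proof. by move=> c x y; apply: mulrDr. Qed.
Lemma alg_scalerDl x : {morph alg_scale^~ x : a b / a + b}.
Proof. by move=> a b; rewrite /alg_scale rmorphD mulrDl. Qed.

HB.instance Definition _ := GRing.Zmodule_isLmodule.Build k (ComPzAlg.sort A)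
  alg_scalerA alg_scale1r alg_scalerDr alg_scalerDl.

Lemma algE c x : c *: x = algmap c * x. Proof. by []. Qed.

Lemma scalemAl c x y : c *: (x * y) = (c *: x) * y.
Proof. exact: mulrA. Qed.

Lemma scalemAr c x y : c *: (x * y) = x * (c *: y).
Proof. exact: mulrCA. Qed.

End ComPzAlgTheory.

(* The algebra over K given by a ring morphism from K. *)
Definition alg_along (K A : comPzRingType) (f : {rmorphism K -> A}) : Type := A.

Section AlgAlong.
Variables (K A : comPzRingType) (f : {rmorphism K -> A}).

HB.instance Definition _ := GRing.ComPzRing.on (alg_along f).
HB.instance Definition _ := ComPzRing_isAlg.Build K (alg_along f)
  (rmorphB f) (rmorphism_monoidP f).
Let along_alg : comPzAlgType K := alg_along f.
HB.instance Definition _ :=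
  GRing.Lmodule.copy (alg_along f) (ComPzAlg.sort along_alg).

End AlgAlong.

Record rbAlg (k : comPzRingType) (lam : k) := RBAlg {
  rb_alg :> comPzAlgType k;
  rbop : rb_alg -> rb_alg;
  rbop_linear : linear rbop;
  rbopM : forall x y : rb_alg,
    rbop x * rbop y = rbop (x * rbop y + rbop x * y + lam *: (x * y))
}.

Arguments rbop {k lam r}.

Definition rb_morphism (k : comPzRingType) (lam : k) (R S : rbAlg lam)
    (f : R -> S) : Prop :=
  [/\ linear f, monoid_morphism f & forall x, f (rbop x) = rbop (f x)].

Record rbHom (k : comPzRingType) (lam : k) (R S : rbAlg lam) := RBHom {
  rbhom_fun :> R -> S;
  rbhomP : rb_morphism rbhom_fun
}.

Section RBHomInstances.
Variables (k : comPzRingType) (lam : k) (R S : rbAlg lam).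
Variable f : rbHom R S.

Let rbhom_linear : linear f. Proof. by case: (rbhomP f). Qed.
Let rbhom_monoid : monoid_morphism f. Proof. by case: (rbhomP f). Qed.

HB.instance Definition _ := GRing.isLinear.Build k R S *:%R f rbhom_linear.
HB.instance Definition _ := GRing.isMonoidMorphism.Build R S f rbhom_monoid.

Lemma rbhom_rbop x : f (rbop x) = rbop (f x).
Proof. by case: (rbhomP f). Qed.

End RBHomInstances.

Definition is_rb_pushout (k : comPzRingType) (lam : k)
    (R0 R1 R2 : rbAlg lam) (f1 : rbHom R0 R1) (f2 : rbHom R0 R2)
    (Q : rbAlg lam) (k1 : R1 -> Q) (k2 : R2 -> Q) : Prop :=
  [/\ rb_morphism k1, rb_morphism k2, forall x, k1 (f1 x) = k2 (f2 x) &
    forall (S : rbAlg lam) (g1 : rbHom R1 S) (g2 : rbHom R2 S),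
      (forall x, g1 (f1 x) = g2 (f2 x)) ->
    exists h : rbHom Q S,
      [/\ forall x, h (k1 x) = g1 x, forall x, h (k2 x) = g2 x &
        forall h' : rbHom Q S, (forall x, h' (k1 x) = g1 x) ->
          (forall x, h' (k2 x) = g2 x) -> forall q, h' q = h q]].

Section Span.
Variables (k : pzRingType) (V : lmodType k).

Definition span (G : V -> Prop) : {pred V} := fun v =>
  `[< forall S : {pred V}, submod_closed S ->
        (forall g, G g -> g \in S) -> v \in S >].

Variable G : V -> Prop.

Lemma spanP v : reflect (forall S : {pred V}, submod_closed S ->
  (forall g, G g -> g \in S) -> v \in S) (v \in span G).
Proof. exact: asboolP. Qed.

Lemma span_submod_closed : submod_closed (span G).
Proof.
split=> [|c u v /spanP uP /spanP vP]; first by apply/spanP=> S [].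
apply/spanP=> S S_sub GS; case: (S_sub) => _; apply; [exact: uP|exact: vP].
Qed.

HB.instance Definition _ :=
  GRing.isSubmodClosed.Build k V (span G) span_submod_closed.

Lemma mem_span g : G g -> g \in span G.
Proof. by move=> Gg; apply/spanP=> S _; apply. Qed.

End Span.

(* The quotient of V by the submodule generated by G. *)
Definition lquot (k : pzRingType) (V : lmodType k) (G : V -> Prop) : Type :=
  Quotient.quot (span G).

Section LQuot.
Variables (k : pzRingType) (V : lmodType k) (G : V -> Prop).

HB.instance Definition _ := GRing.Zmodule.on (lquot G).

Definition lpi (v : V) : lquot G := \pi_(Quotient.quot (span G)) v.
Definition lrepr (x : lquot G) : V := repr (x : Quotient.quot (span G)).

Lemma lreprK x : lpi (lrepr x) = x.
Proof. exact: reprK. Qed.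

Lemma lpi_eq u v : (lpi u == lpi v) = (u - v \in span G).
Proof. by rewrite Quotient.idealrBE. Qed.

Lemma lpi_zmod : zmod_morphism lpi.
Proof. by move=> u v; rewrite /lpi raddfB. Qed.

HB.instance Definition _ := GRing.isZmodMorphism.Build V (lquot G) lpi lpi_zmod.

Definition lquot_scale c (x : lquot G) := lpi (c *: lrepr x).

Lemma lpiZ c v : lquot_scale c (lpi v) = lpi (c *: v).
Proof.
apply/eqP; rewrite lpi_eq -scalerBr rpredZ // -lpi_eq.
by rewrite lreprK.
Qed.

Lemma lquot_scalerA a b v :
  lquot_scale a (lquot_scale b v) = lquot_scale (a * b) v.
Proof. by rewrite -[v]lreprK !lpiZ scalerA. Qed.
Lemma lquot_scale1r : left_id 1 lquot_scale.
Proof. by move=> v; rewrite -[v]lreprK !lpiZ scale1r. Qed.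
Lemma lquot_scalerDr : right_distributive lquot_scale +%R.
Proof.
by move=> c u v; rewrite -[u]lreprK -[v]lreprK -raddfD !lpiZ scalerDr raddfD.
Qed.
Lemma lquot_scalerDl v : {morph lquot_scale^~ v : a b / a + b}.
Proof. by move=> a b; rewrite -[v]lreprK !lpiZ scalerDl raddfD. Qed.

HB.instance Definition _ := GRing.Zmodule_isLmodule.Build k (lquot G)
  lquot_scalerA lquot_scale1r lquot_scalerDr lquot_scalerDl.

Lemma lpi_scalable : scalable lpi.
Proof. by move=> c v; rewrite -lpiZ. Qed.

HB.instance Definition _ :=
  GRing.isScalable.Build k V (lquot G) *:%R lpi lpi_scalable.

End LQuot.

(* Free modules: MathComp's [{malg k[X]}] has a module structure only when k  *)
(* is nontrivial.                                                             *)

Definition freemod (k : pzRingType) (X : choiceType) : Type := {malg k[X]}.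

Section FreeMod.
Variables (k : pzRingType) (X : choiceType).
Local Notation F := (freemod k X).

HB.instance Definition _ := GRing.Zmodule.on F.

Definition freegen (x : X) : F := << 1 *g x >>.

Definition free_scale c (g : F) : F := [malg x in msupp g => c * g@_x].

Lemma free_scaleE c (g : F) x : (free_scale c g)@_x = c * g@_x.
Proof. by rewrite mcoeffE; case: msuppP; rewrite ?mulr0. Qed.

Lemma free_scalerA a b v : free_scale a (free_scale b v) = free_scale (a * b) v.
Proof. by apply/malgP=> x; rewrite !free_scaleE mulrA. Qed.
Lemma free_scale1r : left_id 1 free_scale.
Proof. by move=> v; apply/malgP=> x; rewrite free_scaleE mul1r. Qed.
Lemma free_scalerDr : right_distributive free_scale +%R.
Proof. 
by move=> c u v; apply/malgP=> x; rewrite mcoeffD !free_scaleE mcoeffD mulrDr.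
Qed.
Lemma free_scalerDl v : {morph free_scale^~ v : a b / a + b}.
Proof.
by move=> a b; apply/malgP=> x; rewrite mcoeffD !free_scaleE mulrDl.
Qed.

HB.instance Definition _ := GRing.Zmodule_isLmodule.Build k F
  free_scalerA free_scale1r free_scalerDr free_scalerDl.

Lemma freeE (g : F) : g = \sum_(x <- msupp g) g@_x *: freegen x.
Proof.
rewrite {1}(monalgE g); apply: eq_bigr => x _; apply/malgP=> y.
by rewrite free_scaleE !mcoeffU mulrnAr mulr1.
Qed.

Variable W : lmodType k.
Implicit Types f : X -> W.

Definition free_lift f (g : F) : W := \sum_(x <- msupp g) g@_x *: f x.

Lemma free_liftw f (g : F) (D : {fset X}) : (msupp g `<=` D)%fset ->
  free_lift f g = \sum_(x <- D) g@_x *: f x.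
Proof.
move=> gD; rewrite /free_lift; apply: big_fset_incl => // x _.
by move/mcoeff_outdom=> ->; rewrite scale0r.
Qed.

Lemma free_lift_linear f : linear (free_lift f).
Proof.
move=> c u v; pose D := (msupp u `|` msupp v `|` msupp (c *: u + v))%fset.
rewrite !(@free_liftw f _ D) /D; last first.
- by apply: fsubsetUr.
- by rewrite -fsetUA fsubsetUl.
- by rewrite -fsetUA fsetUCA fsubsetUl.
rewrite scaler_sumr -big_split; apply: eq_bigr => x _ /=.
by rewrite mcoeffD free_scaleE scalerDl scalerA.
Qed.

HB.instance Definition _ f :=
  GRing.isLinear.Build k F W *:%R (free_lift f) (free_lift_linear f).

Lemma free_liftU f x : free_lift f (freegen x) = f x.
Proof.
rewrite (@free_liftw f _ [fset x]%fset) ?msuppU_le //.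
by rewrite big_seq_fset1 mcoeffUU scale1r.
Qed.

Lemma free_liftD f f' g :
  free_lift (fun x => f x + f' x) g = free_lift f g + free_lift f' g.
Proof.
by rewrite -big_split; apply: eq_bigr => x _ /=; rewrite scalerDr.
Qed.

End FreeMod.

Lemma free_liftZ (k : comPzRingType) (X : choiceType) (W : lmodType k)
    (c : k) (f : X -> W) g :
  free_lift (fun x => c *: f x) g = c *: free_lift f g.
Proof.
rewrite scaler_sumr; apply: eq_bigr => x _.
by rewrite !scalerA [c * _]mulrC.
Qed.

Definition bilin_map (k : pzRingType) (U V W : lmodType k) (f : U -> V -> W) :=
  (forall v, linear (f^~ v)) /\ (forall u, linear (f u)).

Section Tensor.
Variables (k : comPzRingType) (U V : lmodType k).

Inductive tens_rel : freemod k (U * V)%type -> Prop :=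
| TensRelL c u u' v : tens_rel
    (freegen k (c *: u + u', v) - (c *: freegen k (u, v) + freegen k (u', v)))
| TensRelR c u v v' : tens_rel
    (freegen k (u, c *: v + v') - (c *: freegen k (u, v) + freegen k (u, v'))).

Definition tens : Type := lquot tens_rel.

HB.instance Definition _ := GRing.Lmodule.on tens.

Definition tpure (u : U) (v : V) : tens := lpi tens_rel (freegen k (u, v)).

Lemma tpure_linearl c u u' v :
  tpure (c *: u + u') v = c *: tpure u v + tpure u' v.
Proof.
rewrite /tpure -!linearP; apply/eqP; rewrite lpi_eq; exact/mem_span/TensRelL.
Qed.

Lemma tpure_linearr c u v v' :
  tpure u (c *: v + v') = c *: tpure u v + tpure u v'.
Proof.
rewrite /tpure -!linearP; apply/eqP; rewrite lpi_eq; exact/mem_span/TensRelR.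
Qed.

Lemma tpure_bilinear : bilin_map tpure.
Proof.
by split=> [v|u] c x y; [apply: tpure_linearl|apply: tpure_linearr].
Qed.

Lemma tpureZl c u v : tpure (c *: u) v = c *: tpure u v.
Proof.
have t0 : tpure 0 v = 0.
  by rewrite -(addNr (0 : U)) -scaleN1r tpure_linearl scaleN1r addNr.
by rewrite -[c *: u]addr0 tpure_linearl t0 addr0.
Qed.

Lemma tpureZr c u v : tpure u (c *: v) = c *: tpure u v.
Proof.
have t0 : tpure u 0 = 0.
  by rewrite -(addNr (0 : V)) -scaleN1r tpure_linearr scaleN1r addNr.
by rewrite -[c *: v]addr0 tpure_linearr t0 addr0.
Qed.

Lemma tens_ind (Q : tens -> Prop) :
  (forall c x y, Q x -> Q y -> Q (c *: x + y)) ->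
  (forall u v, Q (tpure u v)) -> forall x, Q x.
Proof.
move=> Qlin Qp x; rewrite -[x]lreprK [lrepr x]freeE raddf_sum.
elim/big_rec: _ => [|[u v] y _ Qy]; last first.
  by rewrite /= linearZ; apply: Qlin (Qp u v) Qy.
by rewrite -(addNr (tpure 0 0)) -scaleN1r; apply: Qlin.
Qed.

Variable W : lmodType k.
Implicit Types f : U -> V -> W.

(* Meaningful only when f is bilinear: the value at [tpure u v] is then f u v. *)
Definition tlift f (t : tens) : W :=
  free_lift (fun uv => f uv.1 uv.2) (lrepr t).

Lemma tlift_span f x : bilin_map f -> x \in span tens_rel ->
  free_lift (fun uv => f uv.1 uv.2) x = 0.
Proof.
move=> [fl fr] /spanP-/(_ (fun x => free_lift (fun uv => f uv.1 uv.2) x == 0)).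
move=> H; apply/eqP; apply: H => [|_ [c u u' v|c u v v']].
- split=> [|c y z /eqP y0 /eqP z0]; first by rewrite /in_mem /= linear0.
  by rewrite /in_mem /= linearP /= y0 z0 scaler0 addr0.
- by rewrite /in_mem /= linearB linearP /= !free_liftU /= fl subrr.
- by rewrite /in_mem /= linearB linearP /= !free_liftU /= fr subrr.
Qed.

Lemma tlift_pi f x : bilin_map f ->
  tlift f (lpi tens_rel x) = free_lift (fun uv => f uv.1 uv.2) x.
Proof.
move=> fP; apply/eqP; rewrite -subr_eq0 -linearB; apply/eqP/tlift_span => //.
by rewrite -lpi_eq lreprK.
Qed.

Lemma tlift_pure f u v : bilin_map f -> tlift f (tpure u v) = f u v.
Proof. by move=> fP; rewrite tlift_pi // free_liftU. Qed.

Lemma tlift_linear f : bilin_map f -> linear (tlift f).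
Proof.
move=> fP c x y; rewrite -[x]lreprK -[y]lreprK -linearP !tlift_pi //.
by rewrite linearP.
Qed.

Lemma tlift_fun_linear c f f' t :
  tlift (fun u v => c *: f u v + f' u v) t = c *: tlift f t + tlift f' t.
Proof. by rewrite /tlift free_liftD free_liftZ. Qed.

Lemma eq_tlift f f' t : (forall u v, f u v = f' u v) -> tlift f t = tlift f' t.
Proof. by move=> ff'; apply: eq_bigr => x _; rewrite ff'. Qed.

End Tensor.

Section TensorAlg.
Variables (k : comPzRingType) (A B : comPzAlgType k).
Local Notation T := (tens A B).

Definition tmul (s t : T) : T :=
  tlift (fun (a : A) (b : B) =>
    tlift (fun (a' : A) (b' : B) => tpure (a * a') (b * b')) t) s.

Definition tone : T := tpure (1 : A) (1 : B).

Let in_bil (a : A) (b : B) :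
  bilin_map (fun (a' : A) (b' : B) => tpure (a * a') (b * b') : T).
Proof.
split=> [v|u] c x y; rewrite mulrDr -scalemAr;
  [exact: tpure_linearl|exact: tpure_linearr].
Qed.

Let out_bil t :
  bilin_map (fun (a : A) (b : B) =>
    tlift (fun (a' : A) (b' : B) => tpure (a * a') (b * b') : T) t).
Proof.
split=> [v|u] c x y; rewrite -tlift_fun_linear; apply: eq_tlift => a b;
  rewrite mulrDl -scalemAl; [exact: tpure_linearl|exact: tpure_linearr].
Qed.

Lemma tmul_pure a b a' b' :
  tmul (tpure a b) (tpure a' b') = tpure (a * a') (b * b').
Proof. by rewrite /tmul tlift_pure // tlift_pure. Qed.

Lemma tmul_linearl t : linear (tmul^~ t).
Proof. exact: tlift_linear. Qed.

Lemma tmul_linearr s : linear (tmul s).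
Proof.
move=> c x y; rewrite /tmul -tlift_fun_linear; apply: eq_tlift => a b.
exact: tlift_linear.
Qed.

Lemma tmulC : commutative tmul.
Proof.
elim/tens_ind=> [c x y IHx IHy z|a b].
  by rewrite tmul_linearl tmul_linearr IHx IHy.
elim/tens_ind=> [c x y IHx IHy|a' b'].
  by rewrite tmul_linearl tmul_linearr IHx IHy.
by rewrite !tmul_pure [a * _]mulrC [b * _]mulrC.
Qed.

Lemma tmulA : associative tmul.
Proof.
elim/tens_ind=> [c x y IHx IHy s t|a b].
  by rewrite !tmul_linearl IHx IHy.
elim/tens_ind=> [c x y IHx IHy t|a' b'].
  by rewrite tmul_linearl !tmul_linearr tmul_linearl IHx IHy.
elim/tens_ind=> [c x y IHx IHy|a'' b''].
  by rewrite !tmul_linearr IHx IHy.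
by rewrite !tmul_pure !mulrA.
Qed.

Lemma tmul1 : left_id tone tmul.
Proof.
elim/tens_ind=> [c x y IHx IHy|a b]; first by rewrite tmul_linearr IHx IHy.
by rewrite tmul_pure !mul1r.
Qed.

Lemma tmulDl : left_distributive tmul +%R.
Proof. by move=> x y z; rewrite -[x]scale1r tmul_linearl !scale1r. Qed.

(* An alias of [tens A B]: this type gets its module structure from its       *)
(* algebra structure.                                                         *)
Definition atens : Type := T.

HB.instance Definition _ := GRing.Zmodule.on atens.
HB.instance Definition _ :=
  GRing.Zmodule_isComPzRing.Build atens tmulA tmulC tmul1 tmulDl.

Definition apure (a : A) (b : B) : atens := tpure a b.

Lemma apureM a b a' b' : apure a b * apure a' b' = apure (a * a') (b * b').
Proof. exact: tmul_pure. Qed.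

Definition atens_map (c : k) : atens := apure (algmap c) 1.

Lemma atens_map_zmod : zmod_morphism atens_map.
Proof.
move=> c d; rewrite /atens_map /apure rmorphB.
by rewrite -[_ - _]addrC -scaleN1r tpure_linearl scaleN1r addrC.
Qed.

Lemma atens_map_monoid : monoid_morphism atens_map.
Proof.
split=> [|c d]; first by rewrite /atens_map rmorph1.
by rewrite /atens_map apureM mulr1 rmorphM.
Qed.

HB.instance Definition _ :=
  ComPzRing_isAlg.Build k atens atens_map_zmod atens_map_monoid.
Let atens_alg : comPzAlgType k := atens.
HB.instance Definition _ := GRing.Lmodule.copy atens (ComPzAlg.sort atens_alg).

End TensorAlg.

(* R1 and R2 are R0-algebras along f1 and f2; their tensor product over R0 is *)
(* a k-algebra through k -> R0.                                               *)
Section RelativeTensor.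
Variables (k : comPzRingType) (R0 : comPzAlgType k) (R1 R2 : comPzRingType).
Variables (f1 : {rmorphism R0 -> R1}) (f2 : {rmorphism R0 -> R2}).

Definition rtens : Type := atens (alg_along f1) (alg_along f2).

HB.instance Definition _ := GRing.ComPzRing.on rtens.

Definition rtens_map (c : k) : rtens :=
  algmap (algmap c : R0) : atens (alg_along f1) (alg_along f2).

Lemma rtens_map_zmod : zmod_morphism rtens_map.
Proof. by move=> c d; rewrite /rtens_map !rmorphB. Qed.

Lemma rtens_map_monoid : monoid_morphism rtens_map.
Proof.
by split=> [|c d]; rewrite /rtens_map ?rmorph1 // !rmorphM.
Qed.

HB.instance Definition _ :=
  ComPzRing_isAlg.Build k rtens rtens_map_zmod rtens_map_monoid.
Let rtens_alg : comPzAlgType k := rtens.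
HB.instance Definition _ := GRing.Lmodule.copy rtens (ComPzAlg.sort rtens_alg).

Definition rpure (r1 : R1) (r2 : R2) : rtens :=
  apure (r1 : alg_along f1) (r2 : alg_along f2).

Lemma rpureM r1 r2 s1 s2 :
  rpure r1 r2 * rpure s1 s2 = rpure (r1 * s1) (r2 * s2).
Proof. exact: apureM. Qed.

Lemma rpure_balanced r0 r1 r2 : rpure (f1 r0 * r1) r2 = rpure r1 (f2 r0 * r2).
Proof.
pose A1 : comPzAlgType R0 := alg_along f1.
pose A2 : comPzAlgType R0 := alg_along f2.
transitivity (r0 *: (tpure (r1 : A1) (r2 : A2))).
  exact: (tpureZl r0 (r1 : A1) (r2 : A2)).
exact/esym/(tpureZr r0 (r1 : A1) (r2 : A2)).
Qed.

End RelativeTensor.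

Section DirectSum.
Variables (k : pzRingType) (M : nat -> lmodType k).

Definition fin_supp (x : forall n, M n) : Prop :=
  exists N, forall n, (N <= n)%N -> x n = 0.

Record dsum : Type := DSum {
  dsum_val :> forall n, M n;
  dsum_fin : fin_supp dsum_val
}.

HB.instance Definition _ := gen_eqMixin dsum.
HB.instance Definition _ := gen_choiceMixin dsum.

Lemma dsumP (x y : dsum) : (forall n, x n = y n) -> x = y.
Proof.
case: x y => [x xP] [y yP] /= xy.
have {}xy : x = y by apply: functional_extensionality_dep.
by move: yP; rewrite -xy => yP; rewrite (Prop_irrelevance xP yP).
Qed.

Let dsum0P : fin_supp (fun n => 0 : M n). Proof. by exists 0%N. Qed.
Let dsumNP (x : dsum) : fin_supp (fun n => - x n).
Proof. by case: (dsum_fin x) => N xN; exists N => n /xN->; rewrite oppr0. Qed.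
Let dsumDP (x y : dsum) : fin_supp (fun n => x n + y n).
Proof.
case: (dsum_fin x) (dsum_fin y) => [N xN] [N' yN]; exists (maxn N N') => n.
by rewrite geq_max => /andP[/xN-> /yN->]; rewrite addr0.
Qed.
Let dsumZP c (x : dsum) : fin_supp (fun n => c *: x n).
Proof. by case: (dsum_fin x) => N xN; exists N => n /xN->; rewrite scaler0. Qed.

Definition dsum0 := DSum dsum0P.
Definition dsum_opp x := DSum (dsumNP x).
Definition dsum_add x y := DSum (dsumDP x y).
Definition dsum_scale c x := DSum (dsumZP c x).

Let dsum_addA : associative dsum_add.
Proof. by move=> x y z; apply: dsumP => n /=; rewrite addrA. Qed.
Let dsum_addC : commutative dsum_add.
Proof. by move=> x y; apply: dsumP => n /=; rewrite addrC. Qed.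
Let dsum_add0 : left_id dsum0 dsum_add.
Proof. by move=> x; apply: dsumP => n /=; rewrite add0r. Qed.
Let dsum_addN : left_inverse dsum0 dsum_opp dsum_add.
Proof. by move=> x; apply: dsumP => n /=; rewrite addNr. Qed.

HB.instance Definition _ :=
  GRing.isZmodule.Build dsum dsum_addA dsum_addC dsum_add0 dsum_addN.

Let dsum_scaleA a b v : dsum_scale a (dsum_scale b v) = dsum_scale (a * b) v.
Proof. by apply: dsumP => n /=; rewrite scalerA. Qed.
Let dsum_scale1 : left_id 1 dsum_scale.
Proof. by move=> x; apply: dsumP => n /=; rewrite scale1r. Qed.
Let dsum_scaleDr : right_distributive dsum_scale +%R.
Proof. by move=> c x y; apply: dsumP => n /=; rewrite scalerDr. Qed.
Let dsum_scaleDl v : {morph dsum_scale^~ v : a b / a + b}.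
Proof. by move=> a b; apply: dsumP => n /=; rewrite scalerDl. Qed.

HB.instance Definition _ := GRing.Zmodule_isLmodule.Build k dsum
  dsum_scaleA dsum_scale1 dsum_scaleDr dsum_scaleDl.

Lemma dsumE0 n : (0 : dsum) n = 0. Proof. by []. Qed.
Lemma dsumDE (x y : dsum) n : (x + y) n = x n + y n. Proof. by []. Qed.
Lemma dsumZE c (x : dsum) n : (c *: x) n = c *: x n. Proof. by []. Qed.

Definition dsum_in_fun n (u : M n) m : M m :=
  if @eqP nat n m is ReflectT e then eq_rect n (fun i => M i : Type) u m e else 0.

Lemma dsum_in_funE n (u : M n) : dsum_in_fun u n = u.
Proof.
by rewrite /dsum_in_fun; case: eqP => // e; rewrite (eq_irrelevance e erefl).
Qed.

Lemma dsum_in_fun0 n (u : M n) m : n != m -> dsum_in_fun u m = 0.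
Proof. by rewrite /dsum_in_fun; case: eqP. Qed.

Let dsum_in_fin n (u : M n) : fin_supp (dsum_in_fun u).
Proof.
by exists n.+1 => m nm; apply: dsum_in_fun0; rewrite neq_ltn nm.
Qed.

Definition dsum_in n (u : M n) : dsum := DSum (dsum_in_fin u).

Lemma dsum_in_linear n : linear (@dsum_in n).
Proof.
move=> c u v; apply: dsumP => m; rewrite dsumDE dsumZE /=.
have [<-|nm] := eqVneq n m; first by rewrite !dsum_in_funE.
by rewrite !dsum_in_fun0 // scaler0 addr0.
Qed.

HB.instance Definition _ n :=
  GRing.isLinear.Build k (M n) dsum *:%R (@dsum_in n) (@dsum_in_linear n).

Lemma dsum_sumE (I : Type) (r : seq I) (F : I -> dsum) n :
  (\sum_(i <- r) F i) n = \sum_(i <- r) F i n.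
Proof.
by elim: r => [|i r IH]; rewrite ?big_nil // !big_cons dsumDE IH.
Qed.

Lemma dsum_decomp (x : dsum) N : (forall n, (N <= n)%N -> x n = 0) ->
  x = \sum_(n < N) dsum_in (x n).
Proof.
move=> xN; apply: dsumP => m; rewrite dsum_sumE.
have [Nm|mN] := leqP N m.
  rewrite xN // big1 // => i _; apply: dsum_in_fun0.
  by rewrite neq_ltn (leq_trans (ltn_ord i) Nm).
rewrite (bigD1 (Ordinal mN)) //= dsum_in_funE big1 ?addr0 // => i im.
by apply: dsum_in_fun0; apply: contraNneq im => im; apply/eqP/val_inj.
Qed.

Lemma dsum_ind (Q : dsum -> Prop) : Q 0 ->
  (forall x y, Q x -> Q y -> Q (x + y)) ->
  (forall n (u : M n), Q (dsum_in u)) -> forall x, Q x.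
Proof.
move=> Q0 QD Qin x; have [N xN] := dsum_fin x; rewrite (dsum_decomp xN).
by elim/big_ind: _.
Qed.

Definition dsum_bound (x : dsum) : nat := projT1 (cid (dsum_fin x)).

Lemma dsum_boundP x n : (dsum_bound x <= n)%N -> x n = 0.
Proof. by rewrite /dsum_bound; case: cid n. Qed.

Variable W : lmodType k.
Implicit Types (f : forall n, M n -> W) (x : dsum).

(* Meaningful only when every f n is linear. *)
Definition dsum_lift f (x : dsum) : W := \sum_(n < dsum_bound x) f n (x n).

Lemma dsum_liftw f x N : (forall n, f n 0 = 0) ->
  (forall n, (N <= n)%N -> x n = 0) -> dsum_lift f x = \sum_(n < N) f n (x n).
Proof.
move=> f0 xN; rewrite /dsum_lift; set B := dsum_bound x.
suff H C D : (C <= D)%N -> (forall n, (C <= n)%N -> x n = 0) ->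
    \sum_(n < C) f n (x n) = \sum_(n < D) f n (x n).
  by case/orP: (leq_total B N) => le; [|symmetry];
    apply: H => //; apply: dsum_boundP.
move=> CD xC; rewrite (big_ord_widen _ (fun n => f n (x n)) CD) big_mkcond /=.
by apply: eq_bigr => i _; case: ltnP => // /xC->.
Qed.

Lemma dsum_lift_linear f : (forall n, linear (f n)) -> linear (dsum_lift f).
Proof.
move=> fP c x y.
have f0 n : f n 0 = 0.
  by have := fP n (-1) 0 0; rewrite scaler0 addr0 scaleN1r addNr.
pose N := maxn (dsum_bound x) (dsum_bound y).
have xN n : (N <= n)%N -> x n = 0.
  by rewrite geq_max => /andP[/dsum_boundP].
have yN n : (N <= n)%N -> y n = 0.
  by rewrite geq_max => /andP[_ /dsum_boundP].
rewrite !(@dsum_liftw f _ N) //; last first.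
  by move=> n Nn; rewrite dsumDE dsumZE xN // yN // scaler0 addr0.
rewrite scaler_sumr -big_split; apply: eq_bigr => i _ /=.
exact: fP.
Qed.

Lemma dsum_lift_in f n (u : M n) : (forall n, linear (f n)) ->
  dsum_lift f (dsum_in u) = f n u.
Proof.
move=> fP.
have f0 m : f m 0 = 0.
  by have := fP m (-1) 0 0; rewrite scaler0 addr0 scaleN1r addNr.
rewrite (@dsum_liftw f _ n.+1) //; last first.
  by move=> m nm; apply: dsum_in_fun0; rewrite neq_ltn nm.
rewrite (bigD1 ord_max) //= dsum_in_funE big1 ?addr0 // => i ni.
rewrite dsum_in_fun0 //; apply: contraNneq ni => ni.
exact/eqP/val_inj.
Qed.

End DirectSum.

Lemma dsum_lift_fun_linear (k : comPzRingType) (M : nat -> lmodType k)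
    (W : lmodType k) (c : k) (f f' : forall n, M n -> W) (x : dsum M) :
  dsum_lift (fun n u => c *: f n u + f' n u) x =
    c *: dsum_lift f x + dsum_lift f' x.
Proof. by rewrite scaler_sumr -big_split. Qed.

Lemma eq_dsum_lift (k : comPzRingType) (M : nat -> lmodType k)
    (W : lmodType k) (f f' : forall n, M n -> W) (x : dsum M) :
  (forall n u, f n u = f' n u) -> dsum_lift f x = dsum_lift f' x.
Proof. by move=> ff'; apply: eq_bigr => i _. Qed.

(* [tpow A n] is the tensor power of A with n + 1 factors, nested to the      *)
(* right, so that [sha_mod A] is the sum of all positive tensor powers.       *)
Fixpoint tpow (k : comPzRingType) (A : comPzAlgType k) (n : nat) : lmodType k :=
  if n is n'.+1 then tens A (tpow A n') else A.

Definition sha_mod (k : comPzRingType) (A : comPzAlgType k) : Type :=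
  dsum (tpow A).

Section Sha.
Variables (k : comPzRingType) (lam : k) (A : comPzAlgType k).
Local Notation S := (sha_mod A).
Implicit Types (a b c : A) (x y z : S).

HB.instance Definition _ := GRing.Lmodule.on S.

Definition sha_in n (u : tpow A n) : S := dsum_in u.

HB.instance Definition _ n := GRing.isLinear.Build k (tpow A n) S *:%R
  (@sha_in n) (@dsum_in_linear k (tpow A) n).

Definition sha_cons_fun a x n : tpow A n :=
  if n is n'.+1 then tpure a (x n') else 0.

Let sha_cons_fin a x : fin_supp (sha_cons_fun a x).
Proof.
have [N xN] := dsum_fin x; exists N.+1 => -[|n] //= Nn.
rewrite xN // -[0](scale0r (0 : tpow A n)); exact: (etrans (tpureZr 0 a 0) (scale0r _)).
Qed.

(* x |-> a (x) x, raising the degree by one. *)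
Definition sha_cons a x : S := DSum (sha_cons_fin a x).

Lemma sha_cons_linear a : linear (sha_cons a).
Proof.
move=> c x y; apply: dsumP => -[|n].
  by rewrite dsumDE dsumZE /= scaler0 addr0.
by rewrite dsumDE dsumZE /= -tpure_linearr.
Qed.

HB.instance Definition _ a :=
  GRing.isLinear.Build k S S *:%R (sha_cons a) (sha_cons_linear a).

Lemma sha_cons_linearl (r : k) a b x :
  sha_cons (r *: a + b) x = r *: sha_cons a x + sha_cons b x.
Proof.
apply: dsumP => -[|n]; first by rewrite dsumDE dsumZE /= scaler0 addr0.
by rewrite dsumDE dsumZE /= tpure_linearl.
Qed.

Lemma sha_cons_in a n (u : tpow A n) :
  sha_cons a (sha_in u) = @sha_in n.+1 (tpure a u).
Proof.
have t0 m : tpure a (0 : tpow A m) = 0.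
  by rewrite -[0 in LHS](scale0r (0 : tpow A m)) tpureZr scale0r.
apply: dsumP => -[|m] /=; first by rewrite dsum_in_fun0.
have [<-|nm] := eqVneq n m; first by rewrite !dsum_in_funE.
by rewrite !dsum_in_fun0 // t0.
Qed.

(* The mixable shuffle product of elements with m + 1 and n + 1 factors.      *)
Fixpoint sha_dia m {struct m} : forall n, tpow A m -> tpow A n -> S :=
  match m return forall n, tpow A m -> tpow A n -> S with
  | 0 => fun n => match n return A -> tpow A n -> S with
    | 0 => fun a b => @sha_in 0 (a * b : A)
    | n'.+1 => fun a => tlift (fun (b0 : A) (b' : tpow A n') =>
        @sha_in n'.+1 (tpure (a * b0) b'))
    end
  | m'.+1 => fix sha_dia_m n {struct n} : tpow A m'.+1 -> tpow A n -> S :=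
    match n return tpow A m'.+1 -> tpow A n -> S with
    | 0 => fun u b => tlift (fun (a0 : A) (a' : tpow A m') =>
        @sha_in m'.+1 (tpure (a0 * b) a')) u
    | n'.+1 => fun u v =>
        tlift (fun (a0 : A) (a' : tpow A m') =>
        tlift (fun (b0 : A) (b' : tpow A n') =>
          sha_cons (a0 * b0)
            (@sha_dia m' n'.+1 a' (tpure (1 : A) b')
             + sha_dia_m n' (tpure (1 : A) a') b'
             + lam *: @sha_dia m' n' a' b')) v) u
    end
  end.

Definition sha_mul x y : S :=
  dsum_lift (fun m (u : tpow A m) =>
    dsum_lift (fun n (v : tpow A n) => sha_dia u v) y) x.

Let diaF m n (a0 : A) (a' : tpow A m) (b0 : A) (b' : tpow A n) : S :=
  sha_cons (a0 * b0)
    (@sha_dia m n.+1 a' (tpure (1 : A) b')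
     + @sha_dia m.+1 n (tpure (1 : A) a') b' + lam *: @sha_dia m n a' b').

Let diaF_sum (r : k) (p q s p' q' s' : S) :
  r *: p + p' + (r *: q + q') + lam *: (r *: s + s') =
  r *: (p + q + lam *: s) + (p' + q' + lam *: s').
Proof.
rewrite !scalerDr !scalerA [lam * r]mulrC -!addrA.
by congr (_ + _); rewrite !addrA [LHS](ACl (2*4*1*3*5)).
Qed.

Let tpure1_lin n (r : k) (u v : tpow A n) :
  (tpure (1 : A) (r *: u + v) : tpow A n.+1) =
  r *: (tpure (1 : A) u : tpow A n.+1) + (tpure (1 : A) v : tpow A n.+1).
Proof. exact: tpure_linearr. Qed.

Let diaF_bilinearr m n (a0 : A) (a' : tpow A m) :
  bilin_map (@sha_dia m n.+1) -> bilin_map (@sha_dia m.+1 n) ->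
  bilin_map (@sha_dia m n) -> bilin_map (@diaF m n a0 a').
Proof.
move=> h1 h2 h3; split=> [b'|b0] r u v; rewrite /diaF.
  by rewrite mulrDr -scalemAr sha_cons_linearl.
rewrite -linearP -diaF_sum; congr sha_cons.
by rewrite tpure1_lin h1.2 h2.2 h3.2.
Qed.

Let diaF_bilinearl m n (y : tpow A n.+1) :
  bilin_map (@sha_dia m n.+1) -> bilin_map (@sha_dia m.+1 n) ->
  bilin_map (@sha_dia m n) ->
  bilin_map (fun (a0 : A) (a' : tpow A m) => tlift (@diaF m n a0 a') y).
Proof.
move=> h1 h2 h3; split=> [a'|a0] r u v; rewrite -tlift_fun_linear;
    apply: eq_tlift => b0 b'; rewrite /diaF.
  by rewrite mulrDl -scalemAl sha_cons_linearl.
rewrite -linearP -diaF_sum; congr sha_cons.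
by rewrite tpure1_lin h1.1 h2.1 h3.1.
Qed.

Lemma sha_dia_bilinear m n : bilin_map (@sha_dia m n).
Proof.
elim: m n => [|m IHm].
  case=> [|n].
    split=> [b|a] r x y /=; rewrite -linearP; congr (@sha_in 0 _).
      by rewrite mulrDl -scalemAl.
    by rewrite mulrDr -scalemAr.
  have bil a : bilin_map (fun (b0 : A) (b' : tpow A n) =>
      @sha_in n.+1 (tpure (a * b0) b')).
    split=> [v|u] r x y /=; rewrite -linearP; congr (@sha_in n.+1 _).
      by rewrite mulrDr -scalemAr; apply: tpure_linearl.
    exact: tpure_linearr.
  split=> [y|a] r u v /=; last exact: tlift_linear.
  rewrite -tlift_fun_linear; apply: eq_tlift => b0 b'.
  rewrite -linearP; congr (@sha_in n.+1 _).
  by rewrite mulrDl -scalemAl; apply: tpure_linearl.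
elim=> [|n IHn].
  have bil b : bilin_map (fun (a0 : A) (a' : tpow A m) =>
      @sha_in m.+1 (tpure (a0 * b) a')).
    split=> [v|u] r x y /=; rewrite -linearP; congr (@sha_in m.+1 _).
      by rewrite mulrDl -scalemAl; apply: tpure_linearl.
    exact: tpure_linearr.
  split=> [b|x] r u v /=; first exact: tlift_linear.
  rewrite -tlift_fun_linear; apply: eq_tlift => a0 a'.
  rewrite -linearP; congr (@sha_in m.+1 _).
  by rewrite mulrDr -scalemAr; apply: tpure_linearl.
split=> [y|x] r u v; first exact/tlift_linear/diaF_bilinearl.
rewrite [sha_dia x _]/= [sha_dia x u]/= [sha_dia x v]/=.
rewrite -tlift_fun_linear; apply: eq_tlift => a0 a'.
exact/tlift_linear/diaF_bilinearr.
Qed.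

Lemma sha_mul_linearl y : linear (sha_mul^~ y).
Proof.
apply: dsum_lift_linear => m r u v; rewrite -dsum_lift_fun_linear.
by apply: eq_dsum_lift => n w; apply: (sha_dia_bilinear m n).1.
Qed.

Lemma sha_mul_linearr x : linear (sha_mul x).
Proof.
move=> r y z; rewrite /sha_mul -dsum_lift_fun_linear; apply: eq_dsum_lift.
by move=> m u; apply: dsum_lift_linear => n; apply: (sha_dia_bilinear m n).2.
Qed.

Lemma sha_mulDl x y z : sha_mul (x + y) z = sha_mul x z + sha_mul y z.
Proof. by rewrite -[x]scale1r sha_mul_linearl !scale1r. Qed.

Lemma sha_mulDr x y z : sha_mul x (y + z) = sha_mul x y + sha_mul x z.
Proof. by rewrite -[y]scale1r sha_mul_linearr !scale1r. Qed.

Lemma sha_mul0l y : sha_mul 0 y = 0.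
Proof. by apply: (addrI (sha_mul 0 y)); rewrite -sha_mulDl !addr0. Qed.

Lemma sha_mul0r x : sha_mul x 0 = 0.
Proof. by apply: (addrI (sha_mul x 0)); rewrite -sha_mulDr !addr0. Qed.

Lemma sha_mulZl (r : k) x y : sha_mul (r *: x) y = r *: sha_mul x y.
Proof. by rewrite -[r *: x]addr0 sha_mul_linearl sha_mul0l addr0. Qed.

Lemma sha_mulZr (r : k) x y : sha_mul x (r *: y) = r *: sha_mul x y.
Proof. by rewrite -[r *: y]addr0 sha_mul_linearr sha_mul0r addr0. Qed.

Lemma sha_mul_in m n (u : tpow A m) (v : tpow A n) :
  sha_mul (sha_in u) (sha_in v) = sha_dia u v.
Proof.
rewrite /sha_mul dsum_lift_in.
  by rewrite dsum_lift_in // => p; apply: (sha_dia_bilinear m p).2.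
move=> p r x y; rewrite -dsum_lift_fun_linear; apply: eq_dsum_lift => q w.
exact: (sha_dia_bilinear p q).1.
Qed.

Local Notation in0 a := (@sha_in 0 (a : A)).
Local Notation P := (sha_cons 1).

Lemma sha_in_ind (Q : S -> Prop) n :
  (forall (r : k) x y, Q x -> Q y -> Q (r *: x + y)) ->
  (n = 0%N -> forall a, Q (in0 a)) ->
  (forall m, n = m.+1 -> forall a (u : tpow A m), Q (sha_cons a (sha_in u))) ->
  forall u : tpow A n, Q (sha_in u).
Proof.
case: n => [|n] Qlin Q0 Qc; first exact: Q0.
elim/tens_ind => [r u v Qu Qv|a u]; first by rewrite linearP; apply: Qlin.
by rewrite -sha_cons_in; apply: Qc.
Qed.

Lemma sha_ind (Q : S -> Prop) :
  (forall (r : k) x y, Q x -> Q y -> Q (r *: x + y)) ->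
  (forall a, Q (in0 a)) ->
  (forall a n (u : tpow A n), Q (sha_in u) -> Q (sha_cons a (sha_in u))) ->
  forall x, Q x.
Proof.
move=> Qlin Q0 Qc; elim/dsum_ind => [|x y Qx Qy|n].
- by have := Qlin (-1) _ _ (Q0 0) (Q0 0); rewrite scaleN1r addNr.
- by rewrite -[x]scale1r; apply: Qlin.
elim: n => [|n IHn] u; rewrite -/(sha_in u); first exact: Q0.
apply: sha_in_ind u => // m [<-] a u; apply: Qc; exact: IHn.
Qed.

Lemma sha_mul00 a b : sha_mul (in0 a) (in0 b) = in0 (a * b).
Proof. exact: sha_mul_in. Qed.

Lemma sha_mul0c a b y : sha_mul (in0 a) (sha_cons b y) = sha_cons (a * b) y.
Proof.
elim/dsum_ind: y => [|x y IHx IHy|n v].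
- by rewrite !linear0 sha_mul0r.
- by rewrite !linearD sha_mulDr IHx IHy.
rewrite -/(sha_in v) !sha_cons_in sha_mul_in /= tlift_pure //.
split=> [w|c] r x y; rewrite -linearP; congr (@sha_in n.+1 _).
  by rewrite mulrDr -scalemAr; apply: tpure_linearl.
exact: tpure_linearr.
Qed.

Lemma sha_mulc0 a b x : sha_mul (sha_cons a x) (in0 b) = sha_cons (a * b) x.
Proof.
elim/dsum_ind: x => [|x y IHx IHy|n v].
- by rewrite !linear0 sha_mul0l.
- by rewrite !linearD sha_mulDl IHx IHy.
rewrite -/(sha_in v) !sha_cons_in sha_mul_in /= tlift_pure //.
split=> [w|c] r x y; rewrite -linearP; congr (@sha_in n.+1 _).
  by rewrite mulrDl -scalemAl; apply: tpure_linearl.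
exact: tpure_linearr.
Qed.

Definition sha_star x y : S :=
  sha_mul x (P y) + sha_mul (P x) y + lam *: sha_mul x y.

Lemma sha_mulcc a b x y :
  sha_mul (sha_cons a x) (sha_cons b y) = sha_cons (a * b) (sha_star x y).
Proof.
elim/dsum_ind: x => [|x x' IHx IHx'|m u].
- by rewrite /sha_star !linear0 !sha_mul0l !(addr0, scaler0) linear0.
- rewrite linearD sha_mulDl IHx IHx' -linearD; congr sha_cons.
  rewrite /sha_star linearD !sha_mulDl scalerDr !addrA.
  by rewrite [LHS](ACl (1*4*2*5*3*6)).
elim/dsum_ind: y => [|y y' IHy IHy'|n v].
- by rewrite /sha_star !linear0 !sha_mul0r !(addr0, scaler0) linear0.
- rewrite linearD sha_mulDr IHy IHy' -linearD; congr sha_cons.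
  rewrite /sha_star linearD !sha_mulDr scalerDr !addrA.
  by rewrite [LHS](ACl (1*4*2*5*3*6)).
rewrite -/(sha_in u) -/(sha_in v) /sha_star !sha_cons_in !sha_mul_in.
have dia_bil := @sha_dia_bilinear.
rewrite [sha_dia _ _]/= (tlift_pure _ _ (diaF_bilinearl _ _ _ _)) //.
by rewrite (tlift_pure _ _ (diaF_bilinearr _ _ _ _ _)).
Qed.
Lemma sha_mulC : commutative sha_mul.
Proof.
suff H N m n (u : tpow A m) (v : tpow A n) : (m + n < N)%N ->
    sha_mul (sha_in u) (sha_in v) = sha_mul (sha_in v) (sha_in u).
  elim/dsum_ind=> [y|x x' IHx IHx' y|m u].
  - by rewrite sha_mul0l sha_mul0r.
  - by rewrite sha_mulDl sha_mulDr IHx IHx'.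
  elim/dsum_ind=> [|y y' IHy IHy'|n v].
  - by rewrite sha_mul0l sha_mul0r.
  - by rewrite sha_mulDl sha_mulDr IHy IHy'.
  exact: (H (m + n).+1 m n u v).
elim: N m n u v => // N IHN m n u v mnN.
pattern (sha_in u); apply: sha_in_ind u => [r x y IHx IHy|_ a|m' mE a u].
- by rewrite sha_mul_linearl sha_mul_linearr IHx IHy.
- pattern (sha_in v); apply: sha_in_ind v => [r x y IHx IHy|_ b|n' nE b v].
  + by rewrite sha_mul_linearl sha_mul_linearr IHx IHy.
  + by rewrite !sha_mul00 mulrC.
  + by rewrite sha_mul0c sha_mulc0 mulrC.
pattern (sha_in v); apply: sha_in_ind v => [r x y IHx IHy|_ b|n' nE b v].
- by rewrite sha_mul_linearl sha_mul_linearr IHx IHy.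
- by rewrite sha_mul0c sha_mulc0 mulrC.
have swap (x1 x2 x3 y1 y2 y3 : S) : x1 = y2 -> x2 = y1 -> x3 = y3 ->
    x1 + x2 + lam *: x3 = y1 + y2 + lam *: y3.
  by move=> -> -> ->; rewrite [y2 + _]addrC.
rewrite !sha_mulcc mulrC /sha_star !sha_cons_in; congr sha_cons.
move: mnN; rewrite {}mE {}nE addSn addnS ltnS => mnN; apply: swap.
- by apply: (IHN m' n'.+1); rewrite addnS.
- by apply: (IHN m'.+1 n'); rewrite addSn.
- by apply: (IHN m' n'); apply: ltnW.
Qed.

Lemma sha_cons_star x y : P (sha_star x y) = sha_mul (P x) (P y).
Proof. by rewrite sha_mulcc mulr1. Qed.

Let star_mulA x y z :
  let assoc x y z := sha_mul (sha_mul x y) z = sha_mul x (sha_mul y z) in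
  assoc x (P y) (P z) -> assoc (P x) y (P z) -> assoc x y (P z) ->
  assoc (P x) (P y) z -> assoc x (P y) z -> assoc (P x) y z -> assoc x y z ->
  sha_star (sha_star x y) z = sha_star x (sha_star y z).
Proof.
move=> /= h1 h2 h3 h4 h5 h6 h7.
rewrite {1}[sha_star (sha_star x y) z]/sha_star sha_cons_star.
rewrite {1}[sha_star x (sha_star y z)]/sha_star sha_cons_star.
rewrite /sha_star !(sha_mulDl, sha_mulDr, sha_mulZl, sha_mulZr) !scalerDr.
rewrite h1 h2 h3 h4 h5 h6 h7 !addrA.
by rewrite [LHS](ACl (1*2*4*6*3*5*7)).
Qed.

Lemma sha_mulA : associative sha_mul.
Proof.
suff H N m n p (u : tpow A m) (v : tpow A n) (w : tpow A p) :
    (m + n + p < N)%N ->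
    sha_mul (sha_mul (sha_in u) (sha_in v)) (sha_in w) =
    sha_mul (sha_in u) (sha_mul (sha_in v) (sha_in w)).
  elim/dsum_ind=> [y z|x x' IHx IHx' y z|m u].
  - by rewrite !sha_mul0l.
  - by rewrite !sha_mulDl IHx IHx'.
  elim/dsum_ind=> [z|y y' IHy IHy' z|n v].
  - by rewrite sha_mul0l sha_mul0r sha_mul0l.
  - by rewrite !(sha_mulDl, sha_mulDr) IHy IHy'.
  elim/dsum_ind=> [|z z' IHz IHz'|p w].
  - by rewrite !sha_mul0r.
  - by rewrite !sha_mulDr IHz IHz'.
  exact: esym (H (m + n + p).+1 m n p u v w (ltnSn _)).
elim: N m n p u v w => // N IHN m n p u v w mnpN.
pattern (sha_in u); apply: sha_in_ind u => [r x y IHx IHy|_ a|m' mE a u].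
- by rewrite !sha_mul_linearl IHx IHy.
- pattern (sha_in v); apply: sha_in_ind v => [r x y IHx IHy|_ b|n' nE b v].
  + by rewrite sha_mul_linearl !sha_mul_linearr sha_mul_linearl IHx IHy.
  + pattern (sha_in w); apply: sha_in_ind w => [r x y IHx IHy|_ c|p' pE c w].
    * by rewrite !sha_mul_linearr IHx IHy.
    * by rewrite !sha_mul00 mulrA.
    * by rewrite sha_mul00 !sha_mul0c mulrA.
  + pattern (sha_in w); apply: sha_in_ind w => [r x y IHx IHy|_ c|p' pE c w].
    * by rewrite !sha_mul_linearr IHx IHy.
    * by rewrite sha_mul0c !sha_mulc0 sha_mul0c mulrA.
    * by rewrite sha_mul0c !sha_mulcc sha_mul0c mulrA.
- pattern (sha_in v); apply: sha_in_ind v => [r x y IHx IHy|_ b|n' nE b v].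
  + by rewrite sha_mul_linearl !sha_mul_linearr sha_mul_linearl IHx IHy.
  + pattern (sha_in w); apply: sha_in_ind w => [r x y IHx IHy|_ c|p' pE c w].
    * by rewrite !sha_mul_linearr IHx IHy.
    * by rewrite sha_mul00 !sha_mulc0 mulrA.
    * by rewrite sha_mulc0 sha_mul0c !sha_mulcc mulrA.
  pattern (sha_in w); apply: sha_in_ind w => [r x y IHx IHy|_ c|p' pE c w].
  + by rewrite !sha_mul_linearr IHx IHy.
  + by rewrite sha_mulc0 !sha_mulcc sha_mulc0 mulrA.
rewrite !sha_mulcc mulrA star_mulA // ?sha_cons_in; apply: IHN;
  move: mnpN; rewrite mE nE pE !(addSn, addnS) !ltnS => mnpN //;
  by rewrite ?(ltnW mnpN) // ltnW // ltnW.
Qed.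

Lemma sha_mul1 : left_id (in0 1) sha_mul.
Proof.
elim/sha_ind=> [r x y IHx IHy|a|a n u _].
- by rewrite sha_mul_linearr IHx IHy.
- by rewrite sha_mul00 mul1r.
- by rewrite sha_mul0c mul1r.
Qed.

Lemma sha_mul_alg (r : k) x : sha_mul (in0 (algmap r)) x = r *: x.
Proof.
elim/sha_ind: x => [s x y IHx IHy|a|a n u _].
- by rewrite sha_mul_linearr IHx IHy scalerDr !scalerA [s * r]mulrC.
- by rewrite sha_mul00 -algE linearZ.
have cons0 y : sha_cons 0 y = 0.
  by rewrite -(addNr (0 : A)) -scaleN1r sha_cons_linearl scaleN1r addNr.
by rewrite sha_mul0c -algE -[r *: a]addr0 sha_cons_linearl cons0 addr0.
Qed.

End Sha.

(* An alias of [sha_mod A], whose module structure comes from its algebra     *)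
(* structure.                                                                 *)
Definition sha (k : comPzRingType) (lam : k) (A : comPzAlgType k) : Type :=
  sha_mod A.

Section ShaAlg.
Variables (k : comPzRingType) (lam : k) (A : comPzAlgType k).
Local Notation S := (sha lam A).

HB.instance Definition _ := GRing.Zmodule.on S.

Lemma sha_mulDl' : left_distributive (@sha_mul k lam A) +%R.
Proof. by move=> x y z; apply: sha_mulDl. Qed.

HB.instance Definition _ := GRing.Zmodule_isComPzRing.Build S
  (@sha_mulA k lam A) (@sha_mulC k lam A) (@sha_mul1 k lam A) sha_mulDl'.

Definition sha_map (r : k) : S := @sha_in k A 0 (algmap r : A).

Lemma sha_map_zmod : zmod_morphism sha_map.
Proof. by move=> r s; rewrite /sha_map rmorphB linearB. Qed.

Lemma sha_map_monoid : monoid_morphism sha_map.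
Proof.
split=> [|r s]; rewrite /sha_map ?rmorph1 // rmorphM.
exact/esym/sha_mul00.
Qed.

HB.instance Definition _ :=
  ComPzRing_isAlg.Build k S sha_map_zmod sha_map_monoid.
Let sha_alg : comPzAlgType k := S.
HB.instance Definition _ := GRing.Lmodule.copy S (ComPzAlg.sort sha_alg).

Lemma sha_scaleE (r : k) (x : S) : r *: x = (r *: (x : sha_mod A) : sha_mod A).
Proof. exact: (@sha_mul_alg k lam A r x). Qed.

Definition sha_op (x : S) : S := sha_cons 1 x.

Lemma sha_op_linear : linear sha_op.
Proof. by move=> r x y; rewrite !sha_scaleE; apply: sha_cons_linear. Qed.

Lemma sha_opM (x y : S) : sha_op x * sha_op y =
  sha_op (x * sha_op y + sha_op x * y + lam *: (x * y)).
Proof. by rewrite sha_scaleE; apply/esym/sha_cons_star. Qed.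

Definition shaRB : rbAlg lam := RBAlg sha_op_linear sha_opM.

(* The pure tensor a of degree one, and the pure tensor a (x) b. *)
Definition sha1 (a : A) : shaRB := @sha_in k A 0 a.
Definition sha2 (a b : A) : shaRB := @sha_in k A 1 (tpure a b).

End ShaAlg.

Definition rb_ideal (k : comPzRingType) (lam : k) (R : rbAlg lam)
    (I : {pred R}) : Prop :=
  [/\ 0 \in I, {in I &, forall x y, x + y \in I},
      forall a, {in I, forall x, a * x \in I} &
      {in I, forall x, rbop x \in I}].

Record rbIdeal (k : comPzRingType) (lam : k) (R : rbAlg lam) := RBIdeal {
  rbi_mem :> {pred R};
  rbiP : rb_ideal rbi_mem
}.

Section RBIdealGen.
Variables (k : comPzRingType) (lam : k) (R : rbAlg lam) (G : R -> Prop).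

Definition rbgen_mem : {pred R} := fun x =>
  `[< forall I : rbIdeal R, (forall g, G g -> g \in I) -> x \in I >].

Lemma rbgenP : rb_ideal rbgen_mem.
Proof.
split=> [|x y /asboolP xG /asboolP yG|a x /asboolP xG|x /asboolP xG];
  apply/asboolP=> I GI; have [I0 ID IM IP] := rbiP I.
- exact: I0.
- by apply: ID; [apply: xG|apply: yG].
- by apply: IM; apply: xG.
- by apply: IP; apply: xG.
Qed.

Definition rbgen : rbIdeal R := RBIdeal rbgenP.

Lemma mem_rbgen g : G g -> g \in rbgen.
Proof. by move=> Gg; apply/asboolP => I; apply. Qed.

Lemma rbgen_min (I : rbIdeal R) :
  (forall g, G g -> g \in I) -> {subset rbgen <= I}.
Proof. by move=> GI x /asboolP; apply. Qed.

End RBIdealGen.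

Section RBQuot.
Variables (k : comPzRingType) (lam : k) (R : rbAlg lam) (I : rbIdeal R).

Let rbi_zmod : zmod_closed (rbi_mem I).
Proof.
have [I0 ID IM _] := rbiP I; split=> // x y xI yI.
by rewrite -mulN1r; apply: ID => //; apply: IM.
Qed.

HB.instance Definition _ := GRing.isZmodClosed.Build R (rbi_mem I) rbi_zmod.

Definition rbquot : Type := Quotient.quot (rbi_mem I).

HB.instance Definition _ := GRing.Zmodule.on rbquot.

Definition rbpi (x : R) : rbquot := \pi_(Quotient.quot (rbi_mem I)) x.
Definition rbrepr (x : rbquot) : R := repr (x : Quotient.quot (rbi_mem I)).

Lemma rbreprK x : rbpi (rbrepr x) = x.
Proof. exact: reprK. Qed.

Lemma rbpi_eq x y : (rbpi x == rbpi y) = (x - y \in I).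
Proof. by rewrite Quotient.idealrBE. Qed.

Lemma rbpi_zmod : zmod_morphism rbpi.
Proof. by move=> x y; rewrite /rbpi raddfB. Qed.

HB.instance Definition _ := GRing.isZmodMorphism.Build R rbquot rbpi rbpi_zmod.

Definition rbquot_mul x y : rbquot := rbpi (rbrepr x * rbrepr y).

Lemma rbpiM x y : rbquot_mul (rbpi x) (rbpi y) = rbpi (x * y).
Proof.
have [_ ID IM _] := rbiP I.
have rI z : rbrepr (rbpi z) - z \in I by rewrite -rbpi_eq rbreprK.
apply/eqP; rewrite rbpi_eq.
rewrite -[_ * _](subrK (rbrepr (rbpi x) * y)) -mulrBr -addrA -mulrBl.
by apply: ID; [|rewrite mulrC]; apply: IM.
Qed.

Lemma rbquot_mulA : associative rbquot_mul.
Proof.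
move=> x y z; rewrite -[x]rbreprK -[y]rbreprK -[z]rbreprK !rbpiM.
by rewrite mulrA.
Qed.
Lemma rbquot_mulC : commutative rbquot_mul.
Proof. by move=> x y; rewrite /rbquot_mul mulrC. Qed.
Lemma rbquot_mul1 : left_id (rbpi 1) rbquot_mul.
Proof. by move=> x; rewrite -[x]rbreprK rbpiM mul1r. Qed.
Lemma rbquot_mulDl : left_distributive rbquot_mul +%R.
Proof.
move=> x y z; rewrite -[x]rbreprK -[y]rbreprK -[z]rbreprK -raddfD !rbpiM.
by rewrite mulrDl raddfD.
Qed.

HB.instance Definition _ := GRing.Zmodule_isComPzRing.Build rbquot
  rbquot_mulA rbquot_mulC rbquot_mul1 rbquot_mulDl.

Lemma rbpi_monoid : monoid_morphism rbpi.
Proof. by split=> // x y; rewrite -rbpiM. Qed.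

HB.instance Definition _ := GRing.isMonoidMorphism.Build R rbquot rbpi rbpi_monoid.

Definition rbquot_map (c : k) : rbquot := rbpi (algmap c).

Lemma rbquot_map_zmod : zmod_morphism rbquot_map.
Proof. by move=> c d; rewrite /rbquot_map !rmorphB. Qed.
Lemma rbquot_map_monoid : monoid_morphism rbquot_map.
Proof. by split=> [|c d]; rewrite /rbquot_map ?rmorph1 // !rmorphM. Qed.

HB.instance Definition _ :=
  ComPzRing_isAlg.Build k rbquot rbquot_map_zmod rbquot_map_monoid.
Let rbquot_alg : comPzAlgType k := rbquot.
HB.instance Definition _ := GRing.Lmodule.copy rbquot (ComPzAlg.sort rbquot_alg).

Lemma rbpiZ c x : rbpi (c *: x) = c *: rbpi x.
Proof. by rewrite rmorphM. Qed.

Definition rbquot_op (x : rbquot) : rbquot := rbpi (rbop (rbrepr x)).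

Lemma rbquot_opE x : rbquot_op (rbpi x) = rbpi (rbop x).
Proof.
have [_ _ _ IP] := rbiP I; have lin := @rbop_linear _ _ R.
have opB u v : rbop (u - v) = rbop u - rbop v :> R.
  by rewrite -scaleN1r addrC lin scaleN1r addrC.
by apply/eqP; rewrite rbpi_eq -opB; apply: IP; rewrite -rbpi_eq rbreprK.
Qed.

Lemma rbquot_op_linear : linear rbquot_op.
Proof.
move=> c x y; rewrite -[x]rbreprK -[y]rbreprK -rbpiZ -raddfD /= !rbquot_opE.
by rewrite rbop_linear raddfD /= rbpiZ.
Qed.

Lemma rbquot_opM x y : rbquot_op x * rbquot_op y =
  rbquot_op (x * rbquot_op y + rbquot_op x * y + lam *: (x * y)).
Proof.
rewrite -[x]rbreprK -[y]rbreprK !rbquot_opE -!rmorphM /=.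
rewrite -rbpiZ -!raddfD /=; by rewrite rbquot_opE rbopM.
Qed.

Definition rbQuot : rbAlg lam := RBAlg rbquot_op_linear rbquot_opM.

End RBQuot.

Section RBTensor.
Variables (k : comPzRingType) (lam : k) (R0 R1 R2 : rbAlg lam).
Variables (f1 : rbHom R0 R1) (f2 : rbHom R0 R2).

Local Notation T := (rtens f1 f2).
Local Notation "r1 [*] r2" := (rpure f1 f2 r1 r2) (at level 40).

Inductive rbtens_gen : shaRB lam T -> Prop :=
| RBTensGen1 (r1 : R1) :
    rbtens_gen (sha1 lam (rbop r1 [*] 1) - sha2 lam (1 [*] 1) (r1 [*] 1))
| RBTensGen2 (r2 : R2) :
    rbtens_gen (sha1 lam (1 [*] rbop r2) - sha2 lam (1 [*] 1) (1 [*] r2)).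

Definition rbtens_ideal : rbIdeal (shaRB lam T) := rbgen rbtens_gen.

Definition rbtens : rbAlg lam := rbQuot rbtens_ideal.

Definition rbtens1 (r1 : R1) : rbtens :=
  rbpi rbtens_ideal (sha1 lam (r1 [*] 1)).

Definition rbtens2 (r2 : R2) : rbtens :=
  rbpi rbtens_ideal (sha1 lam (1 [*] r2)).

End RBTensor.

(* Main.v *)
Require Import Defs.
From HB Require Import structures.
From mathcomp Require Import all_boot all_algebra.

(** The quotient is a pushout because it is built from three universal
    constructions, composed in order.

    Let g1 and g2 be morphisms into a Rota-Baxter algebra S that agree on R0.
    As plain algebra morphisms they factor through one algebra morphism phi
    from the tensor product, sending r1 [*] r2 to g1 r1 * g2 r2
    ([rtens_liftP]).  Since the shuffle algebra is
    free, phi extends to a Rota-Baxter morphism on it, which must send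
    a0 (x) ... (x) an to phi a0 * P (phi a1 * P (... P (phi an)))
    ([shaRB_liftP]).  Everything about phi so far ignores the operators
    of R1 and R2: that g1 and g2 commute with them says exactly that the
    extension kills the generators of the ideal.  Its kernel is a Rota-Baxter
    ideal, hence contains the whole ideal, and the extension descends to the
    quotient ([rbquot_liftP]).

    The same generators make the two canonical maps commute with the operators,
    as 1 (x) a is the image of a under the operator of the shuffle algebra
    ([sha_op_sha1]).  Uniqueness holds because the pure tensors r1 [*] r2,
    products of elements coming from R1 and from R2, generate the shuffle
    algebra under sums, products and the operator ([rtens_ind],
    [shaRB_ext]).  The argument uses the tensor product only through its
    universal property and is carried out for any pushout of algebras in
    [sha_quot_pushout]. *)

Set Implicit Arguments.
Unset Strict Implicit.
Unset Printing Implicit Defensive.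

Import GRing.Theory.

Local Open Scope ring_scope.

(** * Morphisms out of a relative tensor product *)

Section RelativeTensorLift.
Variables (k : comPzRingType) (R0 : comPzAlgType k) (R1 R2 : comPzRingType).
Variables (f1 : {rmorphism R0 -> R1}) (f2 : {rmorphism R0 -> R2}).
Local Notation T := (rtens f1 f2).
Local Notation "r1 [*] r2" := (rpure f1 f2 r1 r2) (at level 40).

(** Scalars can be absorbed in a pure tensor, so sums suffice.  This keeps the
    R0-module structure, distinct from the k-module structure of [T], out of
    all later arguments. *)
Lemma rtens_ind (Q : T -> Prop) :
  (forall x y, Q x -> Q y -> Q (x + y)) ->
  (forall r1 r2, Q (r1 [*] r2)) -> forall x, Q x.
Proof.
move=> QD Qp x.
pose A1 : comPzAlgType R0 := alg_along f1.
pose A2 : comPzAlgType R0 := alg_along f2.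
(* Absorbing the scalars needs the claim for all multiples at once. *)
suff H (c : R0) (t : tens A1 A2) : Q (c *: t).
  by have := H 1 x; rewrite scale1r.
elim/tens_ind: t c => [d s t Qs Qt c|r1 r2 c].
  by rewrite scalerDr scalerA; apply: QD.
by rewrite -tpureZl; apply: Qp.
Qed.

Lemma rpure_algmap c : algmap c = f1 (algmap c) [*] 1.
Proof.
by rewrite [LHS]/(apure _ _) /rpure; congr (apure _ _).
Qed.

Lemma rpureDl r1 s1 r2 : (r1 + s1) [*] r2 = r1 [*] r2 + s1 [*] r2.
Proof.
pose A1 : comPzAlgType R0 := alg_along f1.
pose A2 : comPzAlgType R0 := alg_along f2.
have := @tpure_linearl R0 A1 A2 1 r1 s1 r2.
by rewrite !scale1r.
Qed.

Lemma rpureDr r1 r2 s2 : r1 [*] (r2 + s2) = r1 [*] r2 + r1 [*] s2.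
Proof.
pose A1 : comPzAlgType R0 := alg_along f1.
pose A2 : comPzAlgType R0 := alg_along f2.
have := @tpure_linearr R0 A1 A2 1 r1 r2 s2.
by rewrite !scale1r.
Qed.

Variables (S : comPzRingType) (g1 : {rmorphism R1 -> S}).
Variable g2 : {rmorphism R2 -> S}.
Hypothesis g12 : forall r0, g1 (f1 r0) = g2 (f2 r0).

(** [S] as an R0-algebra; by [g12] it does not matter through which side,
    and this is what makes the product map balanced. *)
Let S0 : comPzAlgType R0 := alg_along (g1 \o f1).

Let lift_bilin : @bilin_map R0 (alg_along f1) (alg_along f2) S0
  (fun r1 r2 => g1 r1 * g2 r2).
Proof.
split=> [r2|r1] c x y.
  by rewrite !algE rmorphD rmorphM mulrDl -mulrA.
rewrite !algE rmorphD rmorphM mulrDr mulrCA.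
by congr (_ * _ + _); apply/esym/g12.
Qed.

Let additive_lift : exists h : T -> S,
  {morph h : x y / x + y} /\ forall r1 r2, h (r1 [*] r2) = g1 r1 * g2 r2.
Proof.
exists (@tlift R0 (alg_along f1) (alg_along f2) S0
  (fun r1 r2 => g1 r1 * g2 r2)).
split=> [x y|r1 r2]; last exact: tlift_pure lift_bilin.
by have := tlift_linear lift_bilin 1 x y; rewrite !scale1r.
Qed.

Lemma rtens_liftP : exists h : T -> S,
  [/\ {morph h : x y / x + y}, monoid_morphism h &
      forall r1 r2, h (r1 [*] r2) = g1 r1 * g2 r2].
Proof.
have [h [hD hE]] := additive_lift; exists h; split=> //.
split=> [|x y]; first by rewrite [1]/(1 [*] 1) hE !rmorph1 mulr1.
elim/rtens_ind: x => [x x' IHx IHx'|r1 r2].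
  by rewrite mulrDl !hD mulrDl; congr (_ + _).
elim/rtens_ind: y => [y y' IHy IHy'|s1 s2].
  by rewrite mulrDr !hD mulrDr; congr (_ + _).
(* Rewriting with [hE] would compare pure tensors by unfolding quotients. *)
rewrite rpureM; apply: etrans (hE _ _) _; rewrite !rmorphM mulrACA.
by congr (_ * _); apply/esym/hE.
Qed.

End RelativeTensorLift.

(** * Freeness of the mixable shuffle algebra *)

Section ShaLift.
Variables (k : comPzRingType) (lam : k) (A : comPzAlgType k) (R : rbAlg lam).
Variable phi : A -> R.
Hypotheses (phi_linear : linear phi) (phi_monoid : monoid_morphism phi).

Let P_linear : linear (@rbop _ _ R) := @rbop_linear _ _ R.

(** An extension of [phi] has no choice: it is multiplicative and commutes with
    the operators, and a (x) u is the product of a with the operator applied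
    to u. *)
Fixpoint sha_lift_in n : tpow A n -> R :=
  match n return tpow A n -> R with
  | 0 => phi
  | n'.+1 => tlift (fun (a : A) (u : tpow A n') => phi a * rbop (sha_lift_in u))
  end.

Definition sha_lift (x : sha_mod A) : R := dsum_lift sha_lift_in x.

Let step_bilin n : linear (@sha_lift_in n) ->
  bilin_map (fun (a : A) (u : tpow A n) => phi a * rbop (sha_lift_in u)).
Proof.
move=> lin; split=> [u|a] c x y.
  by rewrite phi_linear mulrDl -scalemAl.
by rewrite lin P_linear mulrDr -scalemAr.
Qed.

Let lift_in_linear n : linear (@sha_lift_in n).
Proof. by elim: n => [|n IHn] //=; apply/tlift_linear/step_bilin. Qed.

Lemma sha_lift_linear : linear sha_lift.
Proof. exact/dsum_lift_linear/lift_in_linear. Qed.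

HB.instance Definition _ :=
  GRing.isLinear.Build k (sha_mod A) R *:%R sha_lift sha_lift_linear.
HB.instance Definition _ :=
  GRing.isLinear.Build k R R *:%R (@rbop _ _ R) P_linear.

Lemma sha_lift0 a : sha_lift (@sha_in k A 0 a) = phi a.
Proof. exact/dsum_lift_in/lift_in_linear. Qed.

Lemma sha_lift_cons a x : sha_lift (sha_cons a x) = phi a * rbop (sha_lift x).
Proof.
elim/dsum_ind: x => [|x y IHx IHy|n u].
- by rewrite !linear0 mulr0.
- by rewrite !linearD /= IHx IHy mulrDr.
rewrite -/(sha_in u) sha_cons_in /sha_lift !dsum_lift_in //.
exact/tlift_pure/step_bilin.
Qed.

(** On two tensors of positive length the shuffle product is
    (a * b) (x) (x * P y + P x * y + lam x * y), whose image is a product by the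
    Rota-Baxter identity in [R] once the three shorter products are known to
    be preserved. *)
Lemma sha_liftM x y : sha_lift (sha_mul lam x y) = sha_lift x * sha_lift y.
Proof.
have [phi1 phiM] := phi_monoid.
elim/sha_ind: x y => [r x x' IHx IHx' y|a y|a m u].
- by rewrite sha_mul_linearl !linearP /= IHx IHx' mulrDl -scalemAl.
- elim/sha_ind: y => [r y y' IHy IHy'|b|b n v _].
  + by rewrite sha_mul_linearr !linearP /= IHy IHy' mulrDr -scalemAr.
  + by rewrite sha_mul00 !sha_lift0 phiM.
  + by rewrite sha_mul0c !sha_lift_cons sha_lift0 phiM mulrA.
move: (sha_in u) => {u} x IHx y.
(* The head a stays general in the inner induction: the term P x * y of the
   shuffle needs the claim for the head 1. *)
elim/sha_ind: y a => [r y y' IHy IHy'|b|b n v] a.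
- by rewrite sha_mul_linearr !linearP /= IHy IHy' mulrDr -scalemAr.
- by rewrite sha_mulc0 !sha_lift_cons sha_lift0 phiM mulrAC.
move: (sha_in v) a => {v} y IHy a.
rewrite sha_mulcc !sha_lift_cons phiM mulrACA rbopM; congr (_ * rbop _).
by rewrite !linearD linearZ /= !IHx IHy !sha_lift_cons phi1 !mul1r.
Qed.

Lemma shaRB_liftP :
  exists F : rbHom (shaRB lam A) R, forall a, F (sha1 lam a) = phi a.
Proof.
have [phi1 _] := phi_monoid.
suff FP : rb_morphism (R := shaRB lam A) sha_lift.
  by exists (RBHom FP) => a; apply: sha_lift0.
split; last by move=> x; rewrite sha_lift_cons phi1 mul1r.
- by move=> r x y; rewrite sha_scaleE; apply: sha_lift_linear.
- by split=> [|x y]; [rewrite -phi1; apply: sha_lift0|apply: sha_liftM].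
Qed.

End ShaLift.

Section ShaExt.
Variables (k : comPzRingType) (lam : k) (A : comPzAlgType k).

Lemma sha_op_sha1 (a : A) : rbop (sha1 lam a) = sha2 lam 1 a.
Proof. exact: sha_cons_in. Qed.

Lemma sha_consE (a : A) (x : shaRB lam A) :
  sha_cons a x = sha1 lam a * rbop x.
Proof. by symmetry; apply: etrans (sha_mul0c _ _ _ _) _; rewrite mulr1. Qed.

Lemma sha1_linear : linear (@sha1 k lam A).
Proof.
by move=> c a b; rewrite sha_scaleE; apply: (linearP (@sha_in k A 0)).
Qed.

Lemma sha1_monoid : monoid_morphism (@sha1 k lam A).
Proof. by split=> // a b; apply/esym/sha_mul00. Qed.

(** The degree-one tensors generate: a longer tensor is the product of its head
    with the operator applied to its tail. *)
Lemma shaRB_ext (R : rbAlg lam) (h h' : shaRB lam A -> R) :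
  rb_morphism h -> rb_morphism h' ->
  (forall a, h (sha1 lam a) = h' (sha1 lam a)) -> forall x, h x = h' x.
Proof.
move=> [hl [_ hM] hP] [h'l [_ h'M] h'P] hh'.
elim/sha_ind=> [r x y IHx IHy|a|a n u IHu]; last 2 first.
- exact: hh'.
- by rewrite sha_consE hM h'M hP h'P hh' IHu.
have eq_lin (p q p' q' : R) : p = p' -> q = q' -> r *: p + q = r *: p' + q'.
  by move=> -> ->.
(* The elements carry two convertible module structures, as sums of tensor
   powers and as an algebra; rewriting would confuse them. *)
have := hl r x y; have := h'l r x y; rewrite sha_scaleE => e' e.
by apply: etrans e (etrans _ (esym e')); apply: eq_lin.
Qed.

End ShaExt.

(** * Quotients by Rota-Baxter ideals *)

Section RBQuotLift.
Variables (k : comPzRingType) (lam : k) (R S : rbAlg lam).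

Definition rbker (f : rbHom R S) : {pred R} := fun x => f x == 0.

Lemma rbker_ideal (f : rbHom R S) : rb_ideal (rbker f).
Proof.
have P0 : rbop (0 : S) = 0.
  by have := @rbop_linear _ _ S (-1) 0 0; rewrite !scaleN1r !addNr.
split; rewrite /in_mem /rbker /= ?rmorph0 //.
- by move=> x y /eqP x0 /eqP y0; apply/eqP; rewrite rmorphD /= x0 y0 addr0.
- by move=> a x /eqP x0; apply/eqP; rewrite rmorphM /= x0 mulr0.
- by move=> x /eqP x0; apply/eqP; rewrite /= rbhom_rbop x0.
Qed.

Lemma rbpi_rb_morphism (I : rbIdeal R) : rb_morphism (S := rbQuot I) (rbpi I).
Proof.
split=> [c x y||x]; first by rewrite raddfD /= rbpiZ.
- exact: rbpi_monoid.
- exact/esym/rbquot_opE.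
Qed.

Lemma rbquot_liftP (I : rbIdeal R) (f : rbHom R S) :
  {in I, forall x, f x = 0} ->
  exists h : rbHom (rbQuot I) S, forall x, h (rbpi I x) = f x.
Proof.
move=> fI; pose h (q : rbQuot I) : S := f (rbrepr q).
have hE x : h (rbpi I x) = f x.
  apply/eqP; rewrite -subr_eq0 -rmorphB; apply/eqP/fI.
  by rewrite -rbpi_eq rbreprK.
have [pl [p1 pM] pP] := rbpi_rb_morphism I.
have hP : rb_morphism h.
  split; first 1 last.
  - split=> [|x y]; first by rewrite -p1 hE rmorph1.
    by rewrite -[x]rbreprK -[y]rbreprK -pM !hE rmorphM.
  - by move=> x; rewrite -[x]rbreprK -pP !hE rbhom_rbop.
  - by move=> c x y; rewrite -[x]rbreprK -[y]rbreprK -pl !hE linearP.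
by exists (RBHom hP).
Qed.

End RBQuotLift.

(** * The pushout property *)

Lemma rb_morphism_comp (k : comPzRingType) (lam : k) (R S T : rbAlg lam)
    (g : S -> T) (f : R -> S) :
  rb_morphism g -> rb_morphism f -> rb_morphism (g \o f).
Proof.
move=> [gl [g1 gM] gP] [fl [f1 fM] fP]; split=> [c x y||x] /=.
- by rewrite fl gl.
- by split=> [|x y] /=; rewrite ?f1 ?fM.
- by rewrite fP gP.
Qed.

Lemma rbhom_algmap (k : comPzRingType) (lam : k) (R S : rbAlg lam)
    (f : rbHom R S) c : f (algmap c) = algmap c.
Proof.
by rewrite -[algmap c in LHS]mulr1 -algE linearZ /= rmorph1 algE mulr1.
Qed.

Section ShaPushout.
Variables (k : comPzRingType) (lam : k) (R0 R1 R2 : rbAlg lam).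
Variables (f1 : rbHom R0 R1) (f2 : rbHom R0 R2).
Variables (T : comPzAlgType k) (i1 : R1 -> T) (i2 : R2 -> T).
Hypotheses (i1_linear : linear i1) (i1_monoid : monoid_morphism i1).
Hypotheses (i2_linear : linear i2) (i2_monoid : monoid_morphism i2).
Hypothesis i12 : forall r0, i1 (f1 r0) = i2 (f2 r0).
Hypothesis T_ind : forall Q : T -> Prop,
  (forall x y, Q x -> Q y -> Q (x + y)) ->
  (forall r1 r2, Q (i1 r1 * i2 r2)) -> forall x, Q x.
Hypothesis T_lift : forall (S : rbAlg lam) (g1 : rbHom R1 S) (g2 : rbHom R2 S),
  (forall r0, g1 (f1 r0) = g2 (f2 r0)) ->
  exists phi : T -> S, [/\ linear phi, monoid_morphism phi,
    forall r1, phi (i1 r1) = g1 r1 & forall r2, phi (i2 r2) = g2 r2].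
Variable I : rbIdeal (shaRB lam T).
Hypothesis I_gen1 :
  forall r1, sha1 lam (i1 (rbop r1)) - sha2 lam 1 (i1 r1) \in I.
Hypothesis I_gen2 :
  forall r2, sha1 lam (i2 (rbop r2)) - sha2 lam 1 (i2 r2) \in I.
Hypothesis I_min : forall J : rbIdeal (shaRB lam T),
  (forall r1, sha1 lam (i1 (rbop r1)) - sha2 lam 1 (i1 r1) \in J) ->
  (forall r2, sha1 lam (i2 (rbop r2)) - sha2 lam 1 (i2 r2) \in J) ->
  {subset I <= J}.

Let quot_sha1_morphism (R : rbAlg lam) (i : R -> T) :
  linear i -> monoid_morphism i ->
  (forall r, sha1 lam (i (rbop r)) - sha2 lam 1 (i r) \in I) ->
  rb_morphism (S := rbQuot I) (fun r => rbpi I (sha1 lam (i r))).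
Proof.
have [pl [p1 pM] pP] := rbpi_rb_morphism I.
have [s1 sM] := @sha1_monoid k lam T.
move=> il [i1' iM] iI; split=> [c x y||x].
- by rewrite il sha1_linear pl.
- by split=> [|x y]; rewrite ?i1' ?s1 ?p1 // iM sM pM.
- by rewrite -pP sha_op_sha1; apply/eqP; rewrite rbpi_eq.
Qed.

(** Only the universal property of [T] as a pushout of algebras matters.  The
    quotient forces the two inclusions to commute with the operators, and a
    compatible pair of Rota-Baxter morphisms factors because its extension to
    the shuffle algebra kills the two families of generators. *)
Lemma sha_quot_pushout : is_rb_pushout (Q := rbQuot I) f1 f2
  (fun r1 => rbpi I (sha1 lam (i1 r1))) (fun r2 => rbpi I (sha1 lam (i2 r2))).
Proof.
split=> [||r0|S g1 g2 g12]; [exact: quot_sha1_morphism..|by rewrite i12|].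
have [phi [phi_linear phi_monoid phi1 phi2]] := T_lift g12.
have [F F1] := shaRB_liftP phi_linear phi_monoid.
have F_ideal : {in I, forall x, F x = 0}.
  move=> x xI; apply/eqP; move: x xI.
  (* On generators this is the compatibility of g1 and g2 with the operators. *)
  by apply: (I_min (J := RBIdeal (rbker_ideal F))) => r;
    rewrite /in_mem /= /rbker -sha_op_sha1 rmorphB /= rbhom_rbop !F1 ?phi1 ?phi2
      rbhom_rbop subrr.
have [h hE] := rbquot_liftP F_ideal.
exists h; split=> [r|r|h' h'1 h'2 q]; [by rewrite hE F1 ?phi1 ?phi2..|].
rewrite -[q]rbreprK.
have pi_rb := rbpi_rb_morphism I.
apply: (shaRB_ext (rb_morphism_comp (rbhomP h') pi_rb)
                  (rb_morphism_comp (rbhomP h) pi_rb)) => t /=.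
elim/T_ind: t => [s t IHs IHt|r1 r2].
  rewrite -[s + t]scale1r scalerDr sha1_linear !scale1r.
  by rewrite !rmorphD /= IHs IHt.
rewrite (sha1_monoid _ _).2 !rmorphM /=.
by rewrite h'1 h'2 !hE !F1 phi1 phi2.
Qed.

End ShaPushout.

Theorem theorem4p3 (k : comPzRingType) (lam : k) (R0 R1 R2 : rbAlg lam)
    (f1 : rbHom R0 R1) (f2 : rbHom R0 R2) :
  is_rb_pushout (Q := rbtens f1 f2) f1 f2
    (rbtens1 f1 f2) (rbtens2 f1 f2).
Proof.
have balanced r0 : rpure f1 f2 (f1 r0) 1 = rpure f1 f2 1 (f2 r0).
  by have := rpure_balanced f1 f2 r0 1 1; rewrite !mulr1.
apply: sha_quot_pushout => //.
- move=> c x y.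
  by rewrite !algE rpureDl rpure_algmap rpureM mulr1 /= rbhom_algmap.
- by split=> // x y; rewrite rpureM mulr1.
- move=> c x y.
  rewrite !algE rpureDr rpure_algmap balanced rpureM mulr1 /=.
  by rewrite rbhom_algmap.
- by split=> // x y; rewrite rpureM mulr1.
- move=> Q QD Qp; apply: rtens_ind => // r1 r2.
  by have := Qp r1 r2; rewrite rpureM mulr1 mul1r.
- move=> S g1 g2 g12.
  have [phi [phiD phi_monoid phi_pure]] := rtens_liftP g12.
  exists phi; split=> // [c x y|r1|r2].
  + rewrite phiD; congr (_ + _).
    rewrite algE phi_monoid.2 rpure_algmap phi_pure.
    by rewrite /= !rbhom_algmap rmorph1 mulr1 -algE.
  + by rewrite phi_pure rmorph1 mulr1.
  + by rewrite phi_pure rmorph1 mul1r.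
- by move=> r; apply/mem_rbgen/RBTensGen1.
- by move=> r; apply/mem_rbgen/RBTensGen2.
- by move=> J J1 J2; apply: rbgen_min => _ [].
Qed.
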